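(* Let $X$ be a topological space and let $\operatorname{Open}(X)$ be the frame of open subsets of $X$. An element $U\in\operatorname{Open}(X)$ is a $\mu$-element if and only if $U$ is dense in $X$ or irreducible. In particular, $U$ is essential in $\operatorname{Open}(X)$ if and only if $U$ is dense in $X$.
   Context: In $\operatorname{Open}(X)$, ordered by inclusion, finite meets are intersections, joins are unions, and the bottom element is $\emptyset$. In a lattice with bottom $0$, an element $x$ is a $\mu$-element if for every natural number $n\geqslant 2$ and all elements $y_1,\ldots,y_n$ with $\bigwedge_{k=1}^n y_k\neq 0$, the condition $x\wedge y_k\neq 0$ for every $k$ implies $x\wedge\bigl(\bigwedge_{k=1}^n y_k\bigr)\neq 0$; an element $x$ is essential if $x\wedge y\neq 0$ for all $y\neq 0$. An open set $U$ is irreducible if any two non-empty open subsets of the subspace $U$ have non-empty intersection (with this convention $\emptyset$ is irreducible). *)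

(* Defs.v *)
From HB Require Import structures.
From mathcomp Require Import all_boot all_order.
From mathcomp Require Import all_classical.
From mathcomp Require Import topology.

Set Implicit Arguments.
Unset Strict Implicit.
Unset Printing Implicit Defensive.

Import Order.TTheory.
Local Open Scope classical_set_scope.
Local Open Scope order_scope.

Section LatticeElements.
Context {d : Order.disp_t} {L : bLatticeType d}.
Implicit Types x y : L.

(* L need not have a top, so the meet of the nonempty finite family y_0, ..., y_n
   is iterated from y_0; this is harmless because meet is idempotent (see
   le_fmeet). *)
Definition fmeet (n : nat) (y : 'I_n.+1 -> L) : L :=
  \big[Order.meet/y ord0]_(k < n.+1) y k.

Lemma le_fmeet (n : nat) (y : 'I_n.+1 -> L) x :
  (x <= fmeet y) = [forall k, x <= y k].
Proof.
rewrite /fmeet; apply/idP/forallP => [lexm k|lexy].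
  apply: (le_trans lexm); rewrite unlock.
  elim: (index_enum _) (mem_index_enum k) => //= j s IHs.
  rewrite in_cons => /orP[/eqP->|/IHs]; first exact: leIl.
  by apply: le_trans; exact: leIr.
by apply: (big_ind (fun z => x <= z)) => // u v xu xv; rewrite lexI xu.
Qed.

(* The family of length n.+2 ranges over all lengths at least 2. *)
Definition mu_element x : Prop :=
  forall (n : nat) (y : 'I_n.+2 -> L), fmeet y != \bot ->
    (forall k, x `&` y k != \bot) -> x `&` fmeet y != \bot.

Definition essential x : Prop := forall y, y != \bot -> x `&` y != \bot.

End LatticeElements.

Definition openb (X : topologicalType) : {pred set X} := fun A => `[< open A >].

Section OpenClosed.
Context {X : topologicalType}.

Fact openb_meet : meet_closed (@openb X).
Proof. by move=> A B /asboolP oA /asboolP oB; apply/asboolP; exact: openI. Qed.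

Fact openb_join : join_closed (@openb X).
Proof. by move=> A B /asboolP oA /asboolP oB; apply/asboolP; exact: openU. Qed.

Fact openb_bot : \bot \in @openb X.
Proof. by apply/asboolP; exact: open0. Qed.

Fact openb_top : \top \in @openb X.
Proof. by apply/asboolP; exact: openT. Qed.

HB.instance Definition _ := Order.isTBLatticeClosed.Build _ _ (@openb X)
  openb_meet openb_join openb_bot openb_top.

End OpenClosed.

Record Open (X : topologicalType) :=
  MkOpen { open_set :> set X; openbP : open_set \in @openb X }.

HB.instance Definition _ (X : topologicalType) := [isSub for @open_set X].
HB.instance Definition _ (X : topologicalType) := [Choice of Open X by <:].
HB.instance Definition _ (X : topologicalType) :=
  [SubChoice_isTBSubLattice of Open X by <: with set_display].

Section OpenTheory.
Context {X : topologicalType}.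
Implicit Types U V : Open X.

Lemma open_Open U : open (U : set X).
Proof. exact/asboolP/openbP. Qed.

Lemma leEOpen U V : (U <= V) <-> ((U : set X) `<=` V)%classic.
Proof. by rewrite -subsetEset. Qed.

Lemma meetEOpen U V : (U `&` V : Open X) = ((U : set X) `&` V)%classic :> set X.
Proof. by []. Qed.

Lemma joinEOpen U V : (U `|` V : Open X) = ((U : set X) `|` V)%classic :> set X.
Proof. by []. Qed.

Lemma botEOpen : (\bot : Open X) = set0 :> set X.
Proof. by []. Qed.

Lemma topEOpen : (\top : Open X) = setT :> set X.
Proof. by []. Qed.

End OpenTheory.

(* The subspace topology is that of set_type A; the library's `subspace A` is a
   different topology, on all of X, in which the points outside A are isolated. *)
Definition irreducible (X : topologicalType) (A : set X) : Prop :=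
  (forall V W : set (set_type A),
    open V -> open W -> V !=set0 -> W !=set0 -> V `&` W !=set0)%classic.

(* Main.v *)
Require Import Defs.
From mathcomp Require Import all_boot all_order all_classical topology.

Import Order.LTheory.

Section OpenMu.
Local Open Scope classical_set_scope.
Local Open Scope order_scope.
Context {X : topologicalType}.
Implicit Types U V W : Open X.

(** Nonzero elements of [Open X] are the inhabited open sets, so essential means dense
    ([essential_dense]), and irreducibility becomes a lattice condition ([irreducible_meetP]).
    Essential elements meet any nonzero [fmeet y]; for irreducible [U], the opens meeting [U] are
    stable under finite meets. Conversely, a mu-element that is not essential misses some nonempty
    open set, and pairs of opens enlarged by that set already force irreducibility. *)

Lemma neq_bot_Open V : V != \bot <-> (V : set X) !=set0.
Proof.
split=> [|[x Vx]]; last by apply/eqP => V0; move: Vx; rewrite V0 botEOpen.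
by move=> VN0; apply/set0P; apply: contra VN0 => /eqP V0; apply/eqP/val_inj.
Qed.

Lemma meet_neq_bot V W : V `&` W != \bot <-> exists x, (V : set X) x /\ (W : set X) x.
Proof. exact: neq_bot_Open. Qed.

Definition mkOpen {A : set X} (oA : open A) : Open X :=
  @MkOpen X A (introT (asboolP _) oA).

Lemma essential_dense U : essential U <-> dense (U : set X).
Proof.
split=> [essU O [x Ox] oO|dU V /neq_bot_Open VN0].
  have /essU/meet_neq_bot[y [Uy Oy]] : mkOpen oO != \bot.
    by apply/neq_bot_Open; exists x.
  by exists y.
have [x [Vx Ux]] := dU _ VN0 (open_Open V).
by apply/meet_neq_bot; exists x.
Qed.

(** Open sets of the subspace are exactly the traces on [U] of open sets of [X], so irreducibility
    can be tested inside the lattice. *)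
Lemma irreducible_meetP U :
  irreducible (U : set X) <->
  forall V W, U `&` V != \bot -> U `&` W != \bot -> U `&` (V `&` W) != \bot.
Proof.
split=> [irrU V W /meet_neq_bot[x [Ux Vx]] /meet_neq_bot[y [Uy Wy]]|meetU].
  have oval (Z : Open X) : open (@set_val X U @^-1` (Z : set X)).
    by exists (Z : set X); first exact: open_Open.
  have [||z [Vz Wz]] := irrU _ _ (oval V) (oval W).
  - by exists (SigSub (mem_set Ux)).
  - by exists (SigSub (mem_set Uy)).
  - by apply/meet_neq_bot; exists (set_val z); split=> //; exact: set_valP.
move=> _ _ [V oV <-] [W oW <-] [x Vx] [y Wy].
have /meet_neq_bot[z [Uz [Vz Wz]]] :
    U `&` (mkOpen oV `&` mkOpen oW) != \bot.
  apply: meetU; apply/meet_neq_bot.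
  - by exists (set_val x); split=> //; exact: set_valP.
  - by exists (set_val y); split=> //; exact: set_valP.
by exists (SigSub (mem_set Uz)).
Qed.

Lemma essential_mu U : essential U -> mu_element U.
Proof. by move=> essU n y yN0 _; exact: essU. Qed.

Lemma irreducible_mu U : irreducible (U : set X) -> mu_element U.
Proof.
move=> /irreducible_meetP meetU n y _ UyN0.
(* The base case is the seed [y ord0] of [fmeet], which meets [U] like every [y k]; [meetU] is the
   inductive step. *)
exact: (big_ind (fun V => U `&` V != \bot)).
Qed.

(* If U is disjoint from O != \bot, joining O to both V and W makes their meet
   nonzero without changing their traces on U. *)
Lemma mu_essential_or_irreducible U :
  mu_element U -> essential U \/ irreducible (U : set X).
Proof.
move=> muU; have [|/existsNP[O /not_implyP[ON0 /negP/negPn/eqP UO0]]] :=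
  pselect (essential U); first by left.
right; apply/irreducible_meetP => V W UVN0 UWN0.
have UmeetO Z : U `&` (Z `|` O) = U `&` Z.
  by rewrite -[RHS]joinx0 -UO0; apply: val_inj; exact: setIUr.
pose y (k : 'I_2) : Open X := (if val k == 0%N then V else W) `|` O.
have fy : fmeet y = (V `&` W) `|` O.
  (* The seed repeats [y ord0], so [V] joined with [O] occurs twice; idempotence removes the
     copy. *)
  rewrite /fmeet !big_ord_recl big_ord0 /y /= meetCA meetxx.
  by rewrite meetC; apply: val_inj; exact/esym/setUIl.
rewrite -UmeetO -fy; apply: muU => [|k]; last by rewrite UmeetO; case: ifP.
rewrite fy; apply: contra ON0 => /eqP VWO0.
by rewrite -lex0 -VWO0 leUr.
Qed.

End OpenMu.

Theorem theorem5p6 (X : topologicalType) (U : Open X) :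
  (mu_element U <-> dense (U : set X) \/ irreducible (U : set X)) /\
  (essential U <-> dense (U : set X)).
Proof.
split; last exact: essential_dense.
split=> [/mu_essential_or_irreducible[/essential_dense|]|[/essential_dense|]].
- by left.
- by right.
- exact: essential_mu.
- exact: irreducible_mu.
Qed.
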